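(* Let $\mathbb{F}$ be a field and $\mathbb{E}\supseteq\mathbb{F}$ a field extension. Let $n,k$ be positive integers, $S\subseteq\binom{[n]}{k}$ a nonempty $k$-uniform hypergraph, $w\in\mathfrak{S}_n$ a permutation, and $u\in\mathbb{E}^{n\times n}$ an upper triangular unipotent matrix. Consider the following procedure (Algorithm A): (a) compute $S'\coloneqq\Delta_{uw}(S)$ (over $\mathbb{E}$), let $\sigma_{\max}\coloneqq$ the lexicographically largest element of $S'$, and let $T\coloneqq\{\tau\in\binom{[n]}{k} : \tau <_{\mathrm{lex}} \sigma_{\max}\}$; (b) if $|S'|=|T|+1$, return true; (c) otherwise, let $m$ be a row echelon form, over the field $\mathbb{F}(x_{\operatorname{inv} w})$, of the matrix $(\mathfrak{R}(w)^{\wedge S})_{*T}$; if $\operatorname{ind} m\neq S'\setminus\{\sigma_{\max}\}$ return false, otherwise return true. Then Algorithm A returns true if and only if $\Delta_{\mathfrak{R}(w)}(S)=\Delta_{uw}(S)$.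
   Context: Notation: $[n]=\{1,\dots,n\}$ and $\binom{[n]}{k}$ is the set of $k$-element subsets of $[n]$. The lexicographic order on $\binom{[n]}{k}$: $\sigma <_{\mathrm{lex}} \tau$ iff $\sigma\neq\tau$ and $\min(\sigma\,\triangle\,\tau)\in\sigma$; it identifies $\binom{[n]}{k}$ with $[\binom nk]$. For an $n\times n$ matrix $g$, its $k$-th compound matrix $g^{\wedge k}$ is the $\binom nk\times\binom nk$ matrix with entries $g^{\wedge k}_{\sigma\tau}=\det(g_{ij})_{i\in\sigma,j\in\tau}$ (rows and columns ordered lexicographically). For $S\subseteq\binom{[n]}{k}$, $g^{\wedge S}$ is the submatrix of $g^{\wedge k}$ with rows indexed by $S$, $g^{\wedge S}_{*\sigma}$ denotes its column indexed by $\sigma$, and for $T\subseteq\binom{[n]}{k}$, $g^{\wedge S}_{*T}=(g^{\wedge S}_{*\tau})_{\tau\in T}$. For a matrix $g\in\mathrm{GL}(n,K)$ over a field $K$, the partial shift is $\Delta_g(S)=\{\sigma\in\binom{[n]}{k} : g^{\wedge S}_{*\sigma}\notin\operatorname{Span}_K\{g^{\wedge S}_{*\rho}:\rho<_{\mathrm{lex}}\sigma\}\}$. For a matrix $m$ with columns indexed by a lexicographically ordered set of $k$-subsets, $\operatorname{ind} m$ is the set of indices $\sigma$ such that the column $m_{*\sigma}$ is not in the span of the columns $m_{*\rho}$ with $\rho<_{\mathrm{lex}}\sigma$. For $w\in\mathfrak{S}_n$, $\operatorname{inv} w$ is the set of inversions $(i,j)$, $i<j$, of $w$; $\mathbb{F}(x_{\operatorname{inv}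 w})$ is the field of rational functions over $\mathbb{F}$ in indeterminates $x_{ij}$, $(i,j)\in\operatorname{inv}w$. $\mathfrak{U}(w)$ is the $n\times n$ upper triangular matrix over $\mathbb{F}(x_{\operatorname{inv} w})$ with $1$'s on the diagonal, entry $x_{ij}$ in position $(i,j)$ for $(i,j)\in\operatorname{inv} w$, and $0$ elsewhere; $\mathfrak{R}(w)\coloneqq\mathfrak{U}(w)\,w$, where $w$ also denotes the permutation matrix of $w$ (the same convention is used in the product $uw$). *)

(* Defs.v *)
From HB Require Import structures.
From mathcomp Require Import all_boot all_order all_algebra all_fingroup.
From mathcomp Require Import fraction.
From mathcomp.multinomials Require Import mpoly.

Set Implicit Arguments.
Unset Strict Implicit.
Unset Printing Implicit Defensive.

Import Order.TTheory GRing.Theory.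
Local Open Scope ring_scope.

(* The k-element subsets of [n]; throughout, [n] is rendered as the ordinals
   'I_n = {0, ..., n-1}, so all indices are shifted by one. *)
Record ksub (n k : nat) := KSub {
  kset :> {set 'I_n};
  card_kset : #|kset| == k
}.

HB.instance Definition _ n k := [isSub for @kset n k].
HB.instance Definition _ n k := [Finite of ksub n k by <:].

Section LexOrder.
Variables n k : nat.
Implicit Types s t r : ksub n k.

Definition symdiff s t : {set 'I_n} := (s :\: t) :|: (t :\: s).

(* s != t and the minimum i of the symmetric difference lies in s *)
Definition lexlt s t : bool :=
  (s != t) &&
  [exists i in symdiff s t, [forall j in symdiff s t, (i <= j)%N] && (i \in s)].

Definition lexle s t : bool := (s == t) || lexlt s t.

Lemma lexltP s t :
  reflect (exists i : 'I_n, [/\ i \in s, i \notin t &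
             forall j : 'I_n, (j < i)%N -> (j \in s) = (j \in t)])
          (lexlt s t).
Proof.
apply: (iffP andP) => [[_ /exists_inP[i ist /andP[/forall_inP imin is_]]]|].
  exists i; split=> //; first by move: ist; rewrite !inE is_ andbT orbF.
  move=> j ltji; apply: contraTeq ltji => neq; rewrite -leqNgt; apply: imin.
  by rewrite !inE; move: neq; case: (j \in s); case: (j \in t).
case=> i [is_ it H]; split; first by apply: contraNneq it => <-.
apply/exists_inP; exists i; first by rewrite !inE is_ it.
rewrite is_ andbT; apply/forall_inP => j; rewrite leqNgt.
by apply: contraL => /H; rewrite !inE => ->; case: (j \in t).
Qed.

Fact lexlt_irr : irreflexive lexlt.
Proof. by move=> s; rewrite /lexlt eqxx. Qed.

Fact lexlt_trans : transitive lexlt.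
Proof.
move=> t s r /lexltP[i [is_ it Hi]] /lexltP[j [jt jr Hj]]; apply/lexltP.
case: (ltngtP i j) => [ij|ji|/val_inj eij]; last by rewrite eij jt in it.
  exists i; split=> // [|l li]; first by rewrite -Hj.
  by rewrite Hi // Hj // (ltn_trans li).
exists j; split=> // [|l lj]; first by rewrite Hi.
by rewrite Hi ?Hj // (ltn_trans lj).
Qed.

Fact lexlt_total s t : s != t -> lexlt s t || lexlt t s.
Proof.
move=> neq; have /set0Pn[i0 i0P] : symdiff s t != set0.
  apply: contraNneq neq => e0; apply/eqP/val_inj/setP => i /=.
  by move/setP/(_ i): e0; rewrite !inE; case: (i \in _); case: (i \in _).
case: (@arg_minnP _ i0 (mem (symdiff s t)) val i0P) => i /= ist imin.
have H (j : 'I_n) : (j < i)%N -> (j \in s) = (j \in t).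
  move=> ji; apply: contraTeq ji => ne; rewrite -leqNgt; apply: imin.
  by rewrite !inE; move: ne; case: (j \in s); case: (j \in t).
move: ist; rewrite !inE => /orP[]/andP[it is_]; apply/orP.
  by left; apply/lexltP; exists i.
by right; apply/lexltP; exists i; split=> // j /H.
Qed.

End LexOrder.

Fact lex_display : Order.disp_t. Proof. exact: Order.Disp tt tt. Qed.

HB.instance Definition _ (n k : nat) :=
  @Order.LtOrder.Build lex_display (ksub n k) (@lexle n k) (@lexlt n k) _ _
    (fun _ _ => erefl) (fun _ _ => erefl) (fun _ _ => erefl)
    (@lexlt_irr n k) (@lexlt_trans n k) (@lexlt_total n k).

(* The a-th smallest element of s. *)
Definition kelt n k (s : ksub n k) (a : 'I_k) : 'I_n :=
  enum_val (cast_ord (esym (eqP (card_kset s))) a).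

Section PartialShift.
Variables (K : fieldType) (n k : nat).
Implicit Types (g : 'M[K]_n) (S T : {set ksub n k}).

(* The submatrix of the k-th compound matrix of g with rows S and columns T,
   both in lexicographic order ([Order.enum_val] is increasing, unlike
   [enum_val]).  The compound matrix itself is the case S = T = setT, and
   [compound g S setT] is g^{/\S}. *)
Definition compound g S T : 'M[K]_(#|S|, #|T|) :=
  \matrix_(i, j) \det (mxsub (kelt (Order.enum_val i)) (kelt (Order.enum_val j)) g).

(* The columns of m are labelled, in lexicographic order, by T. *)
Definition ind p T (m : 'M[K]_(p, #|T|)) : {set ksub n k} :=
  [set Order.enum_val j | j : 'I_#|T| &
     col j m \notin
       <<[seq col i m | i <- enum 'I_#|T|
                      & (Order.enum_val i < Order.enum_val j)%O]>>%VS].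

Definition partial_shift g S : {set ksub n k} := ind (compound g S setT).

End PartialShift.

Section RowEchelon.
Variables (K : fieldType) (p q : nat).
Implicit Types A m : 'M[K]_(p, q).

(* Column of the leading entry of row i; equal to q if that row is zero. *)
Definition lead m (i : 'I_p) : nat := find (fun j => m i j != 0) (enum 'I_q).

Definition row_echelon m : Prop :=
  forall i1 i2 : 'I_p, (i1 < i2)%N -> row i2 m != 0 ->
    row i1 m != 0 /\ (lead m i1 < lead m i2)%N.

Definition row_echelon_form_of A m : Prop :=
  row_echelon m /\ exists2 P : 'M[K]_p, P \in unitmx & m = P *m A.

End RowEchelon.

Definition upper_unipotent (K : fieldType) n (u : 'M[K]_n) : Prop :=
  (forall i j : 'I_n, (j < i)%N -> u i j = 0) /\ (forall i, u i i = 1).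

(* Convention: an inversion of w is a pair i < j with w(i) > w(j), and the
   permutation matrix of w is [perm_mx w], with 1's in positions (i, w(i)).
   The two choices go together: with them every product u w, u unipotent upper
   triangular, is of the form u' w b with b unipotent upper triangular and u'
   supported on the diagonal and the inversions of w. *)
Definition inversions n (w : 'S_n) : {set 'I_n * 'I_n} :=
  [set p : 'I_n * 'I_n | (p.1 < p.2)%N && (w p.2 < w p.1)%N].

(* The field F(x_{inv w}); the indeterminate 'X_l stands for x_{ij} where
   (i, j) = enum_val l is the l-th inversion. *)
Notation ratfun F w := {fraction {mpoly F[#|inversions w|]}}.

Section GenericMatrix.
Variables (F : fieldType) (n : nat) (w : 'S_n).

(* The identity plus the sum of x_{ij} E_{ij} over the inversions (i, j). *)
Definition Umat : 'M[ratfun F w]_n :=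
  1%:M + \sum_(l < #|inversions w|)
    (FracField.tofrac ('X_l : {mpoly F[#|inversions w|]})) *:
      delta_mx (enum_val l).1 (enum_val l).2.

Definition Rmat : 'M[ratfun F w]_n := Umat *m perm_mx w.

End GenericMatrix.

Definition lexmax n k (A : {set ksub n k}) (s : ksub n k) : Prop :=
  s \in A /\ forall t, t \in A -> (t <= s)%O.

Definition below n k (s : ksub n k) : {set ksub n k} := [set t | (t < s)%O].

(* [algorithmA F S w u b]: the procedure has a run returning b.  It is a
   relation because any row echelon form m may be used in the last step. *)
Inductive algorithmA (F E : fieldType) n k (S : {set ksub n k}) (w : 'S_n)
    (u : 'M[E]_n) : bool -> Prop :=
| AlgorithmA_initial smax :
    let S' := partial_shift (u *m perm_mx w) S in
    let T := below smax in
    lexmax S' smax -> #|S'| = #|T|.+1 ->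
    algorithmA F S w u true
| AlgorithmA_echelon smax m :
    let S' := partial_shift (u *m perm_mx w) S in
    let T := below smax in
    lexmax S' smax -> #|S'| <> #|T|.+1 ->
    row_echelon_form_of (compound (Rmat F w) S T) m ->
    algorithmA F S w u (ind m == S' :\ smax).

(* Main.v *)
Require Import Defs.
From mathcomp Require Import all_boot all_order all_algebra all_fingroup.
From mathcomp Require Import fraction zify.
From mathcomp.multinomials Require Import mpoly.

Set Implicit Arguments.
Unset Strict Implicit.
Unset Printing Implicit Defensive.

Import GRing.Theory.
Local Open Scope ring_scope.

(** Column operations that add non-inversion columns of u turn u w into a matrix
    u' w with u' supported on the diagonal and the inversions of w, without
    changing the rank of any initial segment of the columns of the compound matrix
    (Cauchy-Binet, and triangularity of compounds of triangular matrices in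
    lexicographic order). Since u' w is a specialization of R(w), a nonzero maximal
    minor of its compound lifts to R(w). Taking the initial segment that ends at
    smax, where u w already has full rank |S|, shows that the shift of S by R(w)
    lies weakly below smax; as both shifts have |S| elements, they agree as soon
    as they agree strictly below smax, which is what the algorithm tests. *)

(** * Enumerations of k-subsets and the Cauchy-Binet formula *)

Lemma mem_kelt n k (s : ksub n k) (a : 'I_k) : kelt s a \in kset s.
Proof. exact: enum_valP. Qed.

Lemma kelt_inj n k (s : ksub n k) : injective (kelt s).
Proof. by move=> a b /enum_val_inj /cast_ord_inj. Qed.

Lemma kelt_onto n k (s : ksub n k) (i : 'I_n) :
  i \in kset s -> exists a, i = kelt s a.
Proof.
move=> si; exists (cast_ord (eqP (card_kset s)) (enum_rank_in si i)).
by rewrite /kelt cast_ordK enum_rankK_in.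
Qed.

(** An injective map from ['I_k] to ['I_n] amounts to its image together with a permutation of
    ['I_k]; this pairing regroups the terms in [Cauchy_Binet]. *)
Definition ksub_perm n k (x : ksub n k * {perm 'I_k}) : {ffun 'I_k -> 'I_n} :=
  [ffun a => kelt x.1 (x.2 a)].

Lemma ksub_perm_inj n k : injective (@ksub_perm n k).
Proof.
move=> [s p] [t q] /ffunP /= eqf.
have est : s = t.
  apply/val_inj/setP => i /=; apply/idP/idP => /kelt_onto[a ->].
    by have:= eqf (p^-1%g a); rewrite !ffunE /= permKV => ->; apply: mem_kelt.
  by have:= eqf (q^-1%g a); rewrite !ffunE /= permKV => <-; apply: mem_kelt.
subst t; congr pair; apply/permP => a; have:= eqf a; rewrite !ffunE /=.
exact: kelt_inj.
Qed.

Lemma ksub_perm_onto n k (f : {ffun 'I_k -> 'I_n}) :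
  injective f -> exists x, f = ksub_perm x.
Proof.
move=> injf; have cardf : #|[set f a | a : 'I_k]| == k.
  by rewrite card_imset ?card_ord.
pose s := KSub cardf.
have fs a : exists b, f a == kelt s b.
  by have [|b ->] := @kelt_onto _ _ s (f a); [apply: imset_f | exists b].
have [p fE] := fin_all_exists fs.
have injp : injective p.
  by move=> a b eqp; apply: injf; rewrite (eqP (fE a)) (eqP (fE b)) eqp.
by exists (s, perm injp); apply/ffunP => a; rewrite ffunE /= permE (eqP (fE a)).
Qed.

(** Expanding the rows of the product gives a sum over all functions f. A non-injective f repeats a
    row of N and contributes 0; the injective ones, grouped by image, assemble the minors of M. *)
Lemma Cauchy_Binet (R : comPzRingType) n k (M : 'M[R]_(k, n)) (N : 'M[R]_(n, k)) :
  \det (M *m N) =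
  \sum_(t : ksub n k) \det (colsub (kelt t) M) * \det (rowsub (kelt t) N).
Proof.
have -> : \det (M *m N) =
    \sum_(f : {ffun 'I_k -> 'I_n}) (\prod_i M i (f i)) * \det (rowsub f N).
  rewrite /determinant; under eq_bigr => p _.
    under eq_bigr => i _ do rewrite mxE.
    rewrite bigA_distr_bigA big_distrr /=; over.
  rewrite exchange_big; apply: eq_bigr => f _; rewrite big_distrr.
  apply: eq_bigr => p _; rewrite big_split /= mulrCA; congr (_ * (_ * _)).
  by apply: eq_bigr => i _; rewrite mxE.
rewrite (bigID (fun f : {ffun 'I_k -> 'I_n} => injectiveb f)) /=.
rewrite [X in _ + X]big1 ?addr0; last first.
  move=> f /injectivePn[i [j neq eqf]].
  by rewrite (determinant_alternate neq) ?mulr0 // => l; rewrite !mxE eqf.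
have -> (G : {ffun 'I_k -> 'I_n} -> R) :
    \sum_(f : {ffun _} | injectiveb f) G f = \sum_x G (@ksub_perm n k x).
  transitivity (\sum_(f in [set ksub_perm x | x : ksub n k * {perm 'I_k}]) G f).
    apply: eq_bigl => f; apply/injectiveP/imsetP => [/ksub_perm_onto[x ->]|].
      by exists x.
    by case=> x _ -> a b; rewrite !ffunE => /kelt_inj/perm_inj.
  by rewrite big_imset //= => x y _ _; apply: ksub_perm_inj.
rewrite -(pair_bigA _ (fun t p => (\prod_i M i (ksub_perm (t, p) i)) *
   \det (rowsub (ksub_perm (t, p)) N))) /=.
apply: eq_bigr => t _; rewrite {2}/determinant big_distrl /=.
apply: eq_bigr => p _.
have -> : rowsub (ksub_perm (t, p)) N = row_perm p (rowsub (kelt t) N).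
  by apply/matrixP => i j; rewrite !mxE ffunE.
rewrite row_permE det_mulmx det_perm [in RHS]mulrC mulrCA mulrC -!mulrA.
rewrite [_ * \det _]mulrC; congr (_ * _); rewrite mulrC; congr (_ * _).
by apply: eq_bigr => i _; rewrite mxE ffunE.
Qed.

(** * Minors of products and of triangular matrices *)

Notation minor g s t := (\det (mxsub (kelt s) (kelt t) g)).

Lemma minor_mul (R : comPzRingType) n k (A B : 'M[R]_n) (s r : ksub n k) :
  minor (A *m B) s r = \sum_(t : ksub n k) minor A s t * minor B t r.
Proof.
rewrite mxsub_mul Cauchy_Binet; apply: eq_bigr => t _.
by congr (_ * _); congr (\det _); apply/matrixP => i j; rewrite !mxE.
Qed.

(** A nonzero Leibniz term at p forces [kelt s a <= kelt t (p a)] for all a, so s has at least as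
    many elements up to i as t. But s and t agree below i, and only t contains i. *)
Lemma minor_upper (R : comPzRingType) n k (b : 'M[R]_n) (s t : ksub n k) :
  (forall i j : 'I_n, (j < i)%N -> b i j = 0) -> (t < s)%O -> minor b s t = 0.
Proof.
move=> bU /lexltP[i [it is_ eqst]]; apply: big1 => p _.
case: (pickP (fun a => kelt t (p a) < kelt s a)%N) => [a lta|lepa].
  by rewrite (bigD1 a) //= mxE bU // mul0r mulr0.
pose A := [set a : 'I_k | (kelt s a <= i)%N].
pose B := [set a : 'I_k | (kelt t (p a) <= i)%N].
have BA : B \subset A.
  apply/subsetP => a; rewrite !inE; apply: leq_trans.
  by rewrite leqNgt lepa.
have cA : #|A| = #|[set j in kset s | (j < i)%N]|.
  rewrite -(card_imset _ (@kelt_inj _ _ s)); apply: eq_card => j; rewrite inE.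
  apply/imsetP/andP => [[a + ->]|[/kelt_onto[a ->] ltai]].
    rewrite inE leq_eqVlt mem_kelt; case: eqP => //= eqi.
    by move: is_; rewrite -(val_inj eqi) mem_kelt.
  by exists a => //; rewrite inE ltnW.
have cB : #|B| = #|i |: [set j in kset t | (j < i)%N]|.
  rewrite -(card_imset _ (inj_comp (@kelt_inj _ _ t) (@perm_inj _ p))).
  apply: eq_card => j; rewrite !inE; apply/imsetP/idP => [[a + ->]|].
    by rewrite inE /= leq_eqVlt mem_kelt.
  have [/eqP ->|/= _ /andP[]] := boolP (j == i); first move=> _.
    have [a ai] := kelt_onto it.
    by exists (p^-1%g a); rewrite /= ?inE permKV -?ai.
  move=> /kelt_onto[a ->] ltai; exists (p^-1%g a); rewrite /= ?inE permKV //.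
  exact: ltnW.
have := subset_leq_card BA; rewrite cA cB cardsU1 inE ltnn andbF /=.
rewrite (_ : [set j in kset s | (j < i)%N] = [set j in kset t | (j < i)%N]).
  by rewrite ltnn.
by apply/setP => j; rewrite !inE; case: ltnP => [/eqst ->|]; rewrite ?andbF.
Qed.

(** Distinct s and t are comparable, so [minor_upper] applies to the identity matrix or to its
    transpose. *)
Lemma minor1 (R : comPzRingType) n k (s t : ksub n k) :
  minor (1%:M : 'M[R]_n) s t = (s == t)%:R.
Proof.
have [->|neq] := eqVneq s t.
  rewrite (_ : mxsub _ _ _ = 1%:M) ?det1 //; apply/matrixP => i j.
  by rewrite !mxE (inj_eq (@kelt_inj _ _ t)).
have U (i j : 'I_n) : (j < i)%N -> (1%:M : 'M[R]_n) i j = 0.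
  by move=> ltji; rewrite mxE -val_eqE gtn_eqF.
have /orP[lt|lt] := lexlt_total neq; last exact: (minor_upper U lt).
rewrite -det_tr trmx_mxsub tr_scalar_mx; exact: (minor_upper U lt).
Qed.

(** * Products of compound matrices on initial segments of columns *)

Lemma big_Order_enum_val (R : nmodType) n k (T : {set ksub n k}) (G : ksub n k -> R) :
  \sum_(j < #|T|) G (Order.enum_val j) = \sum_(t in T) G t.
Proof.
have [->|[t0 t0T]] := set_0Vmem T.
  rewrite big_set0; apply: big1 => j _.
  by have := Order.EnumVal.enum_valP j; rewrite inE.
rewrite (reindex (Order.enum_val : 'I_#|T| -> ksub n k)) /=; last first.
  exact: (Order.EnumVal.enum_val_bij_in t0T).
by apply: eq_bigl => j; rewrite Order.EnumVal.enum_valP.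
Qed.

Section Compound.
Variables (K : fieldType) (n k : nat).
Implicit Types (g h b : 'M[K]_n) (S T : {set ksub n k}).

Lemma compound_mul g h S T :
  compound (g *m h) S T = compound g S setT *m compound h setT T.
Proof.
apply/matrixP => i j; rewrite !mxE minor_mul.
under [RHS]eq_bigr => l _ do rewrite !mxE.
rewrite (@big_Order_enum_val _ _ _ [set: ksub n k]
  (fun t => minor g (Order.enum_val i) t * minor h t (Order.enum_val j))).
by apply: eq_bigl => t; rewrite inE.
Qed.

Lemma compound1 S : compound (1%:M : 'M[K]_n) S S = 1%:M.
Proof.
apply/matrixP => i j; rewrite !mxE minor1.
by rewrite (inj_eq (@Order.EnumVal.enum_val_inj _ _ _)).
Qed.

(** Cauchy-Binet terms with index outside the initial segment T vanish: such an index lies above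
    every column in T, so [minor_upper] applies. *)
Lemma compound_mul_upper g b S T :
  (forall i j : 'I_n, (j < i)%N -> b i j = 0) ->
  (forall s t, t \in T -> (s < t)%O -> s \in T) ->
  compound (g *m b) S T = compound g S T *m compound b T T.
Proof.
move=> bU downT; apply/matrixP => i j; rewrite !mxE minor_mul.
under [RHS]eq_bigr => l _ do rewrite !mxE.
rewrite (@big_Order_enum_val _ _ _ T
  (fun t => minor g (Order.enum_val i) t * minor b t (Order.enum_val j))).
rewrite [RHS]big_mkcond; apply: eq_bigr => t _; case: ifP => // /negbT tT.
rewrite (minor_upper bU) ?mulr0 //.
have jT := Order.EnumVal.enum_valP j.
rewrite Order.TotalTheory.ltNge Order.POrderTheory.le_eqVlt negb_or.
apply/andP; split; first by apply: contraNneq tT => ->.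
by apply: contra tT; apply: downT.
Qed.

(* Multiplying [compound b^-1 * compound b = 1] out blockwise, the block of
   [compound b] with rows outside T vanishes. *)
Lemma compound_upper_unit b T :
  (forall i j : 'I_n, (j < i)%N -> b i j = 0) -> b \in unitmx ->
  (forall s t, t \in T -> (s < t)%O -> s \in T) ->
  compound b T T \in unitmx.
Proof.
move=> bU bunit downT.
have := compound_mul_upper (invmx b) T bU downT.
by rewrite mulVmx // compound1 => /esym/mulmx1_unit[].
Qed.

End Compound.

(** * Greedy bases of families of vectors over a finite total order *)

Lemma mem_filter_enum (X : finType) (T : {set X}) (P : pred X) x :
  (x \in [seq y <- enum T | P y]) = P x && (x \in T).
Proof. by rewrite mem_filter mem_enum. Qed.

Lemma dim_span_cons (K : fieldType) (V : vectType K) (y : V) (s : seq V) :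
  \dim <<y :: s>> = ((y \notin <<s>>%VS) + \dim <<s>>)%N.
Proof.
rewrite span_cons; case: (boolP (y \in _)) => [ys|ys] /=.
  by rewrite (addv_idPr _) // -memvE.
have y0 : y != 0 by apply: contraNneq ys => ->; rewrite mem0v.
rewrite dimv_disjoint_sum ?dim_vline ?y0 //; apply/eqP; rewrite -subv0.
apply/subvP => z /memv_capP[/vlineP[c ->] zs]; rewrite memv0.
apply: contraR ys; rewrite scaler_eq0 (negPf y0) orbF => c0.
by rewrite -[y]scale1r -(mulVf c0) -scalerA memvZ.
Qed.

Section Pivots.
Variables (d : Order.disp_t) (X : finOrderType d) (K : fieldType) (V : vectType K).
Implicit Types (v : X -> V) (T : {set X}) (x y : X).

(** The index set of the greedy basis of the span of v over T. It is [ind] freed from the labelling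
    of matrix columns, which makes different T comparable. *)
Definition pivots v T : {set X} :=
  [set x in T | v x \notin <<[seq v y | y <- enum T & (y < x)%O]>>%VS].

Lemma eq_notin_span v x (s t : seq X) : s =i t ->
  (v x \notin <<[seq v y | y <- s]>>%VS) = (v x \notin <<[seq v y | y <- t]>>%VS).
Proof. by move=> /(eq_mem_map v)/eq_span ->. Qed.

Lemma pivots_down v T :
  (forall x y, y \in T -> (x < y)%O -> x \in T) ->
  pivots v T = pivots v setT :&: T.
Proof.
move=> downT; apply/setP => x; rewrite !inE andbC.
case: (boolP (x \in T)) => [xT|_]; last by rewrite !andbF.
rewrite !andbT; apply: eq_notin_span => y; rewrite !mem_filter_enum inE andbT.
by case: (boolP (y < x)%O) => //= /(downT _ _ xT) ->.
Qed.

(** Induction on T, removing its largest element x: the dimension grows by one exactly when x is a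
    pivot, and x does not affect whether smaller elements are pivots. *)
Lemma card_pivots v T : #|pivots v T| = \dim <<[seq v y | y <- enum T]>>.
Proof.
have [m leTm] := ubnP #|T|; elim: m => // m IHm in T leTm *.
have [->|[x0 x0T]] := set_0Vmem T.
  rewrite enum_set0 span_nil dimv0; apply: eq_card0 => x.
  by rewrite !inE.
pose x := Order.arg_max x0 (mem T) id.
have [xT xmax] : x \in T /\ forall y, y \in T -> (y <= x)%O.
  by rewrite /x; case: Order.TotalTheory.arg_maxP.
have -> : <<[seq v y | y <- enum T]>>%VS = <<v x :: [seq v y | y <- enum (T :\ x)]>>%VS.
  apply: eq_span => z; rewrite -map_cons; apply/mapP/mapP => -[y yP ->]; exists y => //.
    by move: yP; rewrite !inE !mem_enum !inE; case: eqP.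
  by move: yP; rewrite !inE !mem_enum !inE; case: eqP => [->|].
have ltTx y : (y \in T) && (y < x)%O = (y \in T :\ x).
  rewrite !inE Order.POrderTheory.lt_neqAle; case: (boolP (y \in T)) => yT //=.
    by rewrite xmax.
  by rewrite andbF.
rewrite dim_span_cons -IHm; last first.
  by move: leTm; rewrite (cardsD1 x T) xT.
rewrite (cardsD1 x); congr (_ + _)%N.
  rewrite inE xT /=; congr nat_of_bool.
  by apply: eq_notin_span => y; rewrite mem_filter_enum mem_enum andbC ltTx.
apply: eq_card => y; rewrite !inE -andbA; case: eqP => //= /eqP neq.
case: (boolP (y \in T)) => //= yT; apply: eq_notin_span => z.
rewrite !mem_filter_enum !inE.
by case: eqP => [->|] //=; rewrite Order.TotalTheory.ltNge xmax.
Qed.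

End Pivots.

Lemma ind_pivots (K : fieldType) n k p (T : {set ksub n k}) (m : 'M[K]_(p, #|T|))
    (v : ksub n k -> 'cV[K]_p) :
  (forall j, col j m = v (Order.enum_val j)) -> ind m = pivots v T.
Proof.
move=> mv; have onto t : t \in T -> exists j : 'I_#|T|, t = Order.enum_val j.
  move=> tT; exists (Order.enum_rank_in tT t).
  by rewrite Order.EnumVal.enum_rankK_in.
have eqs (j : 'I_#|T|) : <<[seq col i m | i <- enum 'I_#|T|
      & (Order.enum_val i < Order.enum_val j)%O]>>%VS =
    <<[seq v y | y <- enum T & (y < Order.enum_val j)%O]>>%VS.
  apply: eq_span => z; apply/mapP/mapP => -[y]; rewrite mem_filter => /andP[lt yT] ->.
    exists (Order.enum_val y); rewrite // mem_filter lt mem_enum.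
    exact: Order.EnumVal.enum_valP.
  rewrite mem_enum in yT; have [i yi] := onto y yT.
  by exists i; rewrite ?mv ?yi // mem_filter mem_enum -yi lt.
apply/setP => t; rewrite inE; apply/imsetP/andP => [[j + ->]|[/onto[j ->] tP]].
  by rewrite inE eqs mv Order.EnumVal.enum_valP.
by exists j => //; rewrite inE eqs mv.
Qed.

(** Multiplication by P is an injective linear map on columns, so it preserves and reflects
    membership in spans. Hence every row echelon form has the [ind] of the original matrix. *)
Lemma ind_unitmx (K : fieldType) n k p (T : {set ksub n k}) (m : 'M[K]_(p, #|T|))
    (P : 'M[K]_p) : P \in unitmx -> ind (P *m m) = ind m.
Proof.
move=> Pu; pose f : 'Hom('cV[K]_p, 'cV[K]_p) := linfun (mulmx P).
have fker : lker f == 0%VS.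
  by apply/lker0P => x y; rewrite !lfunE /= => /(canRL (mulKmx Pu)) ->; rewrite mulKmx.
have colf j : col j (P *m m) = f (col j m) by rewrite lfunE /= colE -mulmxA -colE.
have eqj (j : 'I_#|T|) s : (col j (P *m m) \notin <<[seq col i (P *m m) | i <- s]>>%VS) =
    (col j m \notin <<[seq col i m | i <- s]>>%VS).
  rewrite colf (eq_map colf) (map_comp f (fun i => col i m)) -limg_span.
  by rewrite !memvE -limg_line limg_ker0.
by apply/setP => t; apply/imsetP/imsetP => -[j + ->]; rewrite inE ?eqj => jP;
  exists j => //; rewrite inE ?eqj.
Qed.

(** * Full row rank: right inverses, maximal minors, spanning columns *)

Section FullRank.
Variables (K : fieldType) (p q : nat).

(** With its converse below, this restates full row rank through a maximal minor, the form that can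
    be carried along ring morphisms. *)
Lemma unitmx_minor_right_inv (A : 'M[K]_(p, q)) (f : 'I_p -> 'I_q) :
  colsub f A \in unitmx -> exists X, A *m X = 1%:M.
Proof.
move=> fu; exists (colsub f 1%:M *m invmx (colsub f A)).
by rewrite mulmxA mulmx_colsub mulmx1 mulmxV.
Qed.

Lemma right_inv_unitmx_minor (A : 'M[K]_(p, q)) X :
  A *m X = 1%:M -> exists f : 'I_p -> 'I_q, colsub f A \in unitmx.
Proof.
move=> AX; have full : row_full A^T.
  by apply/row_fullP; exists X^T; rewrite -trmx_mul AX trmx1.
exists (fullrankfun full); rewrite -unitmx_tr trmx_mxsub.
exact: fullrowsub_unit.
Qed.

Lemma span_cols_fullP (A : 'M[K]_(p, q)) :
  <<[seq col j A | j <- enum 'I_q]>>%VS = fullv <-> exists X, A *m X = 1%:M.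
Proof.
have AE (c : 'cV[K]_q) : A *m c = \sum_j c j 0 *: col j A.
  apply/matrixP => i l; rewrite summxE !mxE; apply: eq_bigr => j _.
  by rewrite !mxE (ord1 l) mulrC.
split=> [full|[X AX]].
  pose f : 'Hom('cV[K]_q, 'cV[K]_p) := linfun (mulmx A).
  have sub : (<<[seq col j A | j <- enum 'I_q]>> <= limg f)%VS.
    apply/span_subvP => _ /mapP[j _ ->]; rewrite colE.
    by rewrite -[A *m _](lfunE (mulmx A)) memv_img ?memvf.
  have ex (i : 'I_p) : exists c : 'cV[K]_q, A *m c = delta_mx i 0.
    have /(subvP sub)/memv_imgP[c _ ->] :
        (delta_mx i 0 : 'cV[K]_p) \in <<[seq col j A | j <- enum 'I_q]>>%VS.
      by rewrite full memvf.
    by exists c; rewrite lfunE.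
  have [c cE] := fin_all_exists ex.
  exists (\matrix_(l, i) c i l 0); apply/matrixP => l i.
  have /matrixP/(_ l 0) := cE i; rewrite !mxE eqxx andbT => <-.
  by apply: eq_bigr => j _; rewrite mxE.
apply/vspaceP => y; rewrite memvf.
rewrite -[y]mul1mx -AX -mulmxA AE; apply: memv_suml => j _.
by apply: memvZ; apply: memv_span; apply: map_f; rewrite mem_enum.
Qed.

End FullRank.

(** * Existence of row echelon forms by Gaussian elimination *)

Section RowEchelonExistence.
Variable K : fieldType.

Lemma lead_le p q (m : 'M[K]_(p, q)) i j : m i j != 0 -> (lead m i <= j)%N.
Proof.
move=> mij; rewrite leqNgt; apply/negP => /(before_find j).
by rewrite nth_ord_enum mij.
Qed.

Lemma lead_ex p q (m : 'M[K]_(p, q)) i :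
  row i m != 0 -> exists2 j : 'I_q, m i j != 0 & lead m i = j.
Proof.
move=> mi; have hasm : has (fun j => m i j != 0) (enum 'I_q).
  apply: contraR mi => /hasPn m0; apply/eqP/rowP => j; rewrite !mxE.
  by apply/eqP; rewrite -[_ == 0]negbK m0 ?mem_enum.
have := hasm; rewrite has_find size_enum_ord => lt.
exists (Ordinal lt) => //; have := nth_find (Ordinal lt) hasm.
by rewrite -[find _ _]/(val (Ordinal lt)) nth_ord_enum.
Qed.

(** An entrywise condition that implies [row_echelon] and, not mentioning [lead], passes easily
    through block decompositions. *)
Definition staircase p q (m : 'M[K]_(p, q)) : Prop :=
  forall (i1 i2 : 'I_p) (j : 'I_q), (i1 < i2)%N -> m i2 j != 0 ->
    exists2 j1 : 'I_q, (j1 < j)%N & m i1 j1 != 0.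

Lemma staircase_row_echelon p q (m : 'M[K]_(p, q)) : staircase m -> row_echelon m.
Proof.
move=> stm i1 i2 lti /lead_ex[j mj ->]; have [j1 ltj mj1] := stm _ _ _ lti mj.
split; last exact: leq_ltn_trans (lead_le mj1) ltj.
by apply: contraNneq mj1 => /rowP/(_ j1); rewrite !mxE => ->.
Qed.

(** Induction on the number of columns. A zero first column is skipped; otherwise a pivot is swapped
    to the top, the column below it is cleared, and the induction continues on the lower right
    block. *)
Lemma staircase_exists p q (A : 'M[K]_(p, q)) :
  exists2 P : 'M[K]_p, P \in unitmx & staircase (P *m A).
Proof.
elim: q p A => [|q IHq] p A.
  by exists 1%:M; [apply: unitmx1 | move=> i1 i2 []].
rewrite -[q.+1]/(1 + q)%N in A *.
have [A0|] := eqVneq (lsubmx A) 0.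
  have [P Pu stP] := IHq _ (rsubmx A); exists P => //.
  rewrite -[A]hsubmxK A0 mul_mx_row mulmx0 => i1 i2 j lti.
  case: (split_ordP j) => j' ->; first by rewrite row_mxEl mxE eqxx.
  rewrite row_mxEr => /(stP _ _ _ lti)[j1 ltj mj1].
  by exists (rshift 1 j1); rewrite ?row_mxEr //= ltn_add2l.
case: p A => [|p] A; first by rewrite [lsubmx A]flatmx0 eqxx.
case/matrix0Pn => i0 [z]; rewrite ord1 mxE => pivot.
rewrite -[p.+1]/(1 + p)%N in A i0 pivot *.
pose B : 'M[K]_(1 + p, 1 + q) := xrow (lshift p 0) i0 A.
have Bpiv : ulsubmx B 0 0 != 0 by rewrite !mxE tpermL.
pose a := ulsubmx B 0 0; pose c := dlsubmx B.
pose E : 'M[K]_(1 + p) := block_mx 1%:M 0 (- a^-1 *: c) 1%:M.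
have EB : E *m B = block_mx a%:M (ursubmx B) 0 (drsubmx B - a^-1 *: c *m ursubmx B).
  rewrite -[B in LHS]submxK mulmx_block !mul1mx !mul0mx !addr0.
  rewrite [ulsubmx B]mx11_scalar -/a mul_mx_scalar scalerA mulrN mulfV //.
  by rewrite scaleN1r addNr scaleNr mulNmx [- _ + _]addrC.
have [P Pu stP] := IHq _ (drsubmx B - a^-1 *: c *m ursubmx B).
exists (block_mx 1%:M 0 0 P *m (E *m tperm_mx (lshift p 0) i0)).
  rewrite !unitmx_mul unitmxE det_ublock det1 mul1r -unitmxE Pu.
  by rewrite unitmxE det_lblock !det1 mulr1 unitr1 unitmx_perm.
rewrite -!mulmxA -xrowE -/B EB mulmx_block !mul1mx !mul0mx !mulmx0 !addr0 !add0r.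
move=> i1 i2 j; case: (split_ordP i2) => i2' ->.
  by rewrite /= (ord1 i2').
case: (split_ordP j) => j' ->; first by rewrite block_mxEdl mxE eqxx.
rewrite block_mxEdr; case: (split_ordP i1) => i1' -> lti mi2.
  (* The pivot, in column 0, is strictly left of every column of the right block. *)
  exists (lshift q 0); first by [].
  by rewrite block_mxEul (ord1 i1') mxE eqxx.
have [|j1 ltj mj1] := stP i1' _ _ _ mi2; first by rewrite -(ltn_add2l 1).
by exists (rshift 1 j1); rewrite ?block_mxEdr //= ltn_add2l.
Qed.

Lemma row_echelon_form_exists p q (A : 'M[K]_(p, q)) :
  exists m, row_echelon_form_of A m.
Proof.
have [P Pu stP] := staircase_exists A; exists (P *m A).
by split; [apply: staircase_row_echelon | exists P].
Qed.

End RowEchelonExistence.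

(** * Clearing the entries of u outside the diagonal and the inversions *)

Section BruhatFactor.
Variables (K : fieldType) (n : nat) (w : 'S_n) (u : 'M[K]_n).
Hypothesis u_unip : upper_unipotent u.

Let uU : forall i j : 'I_n, (j < i)%N -> u i j = 0 := u_unip.1.
Let u1 : forall i, u i i = 1 := u_unip.2.

(* Back substitution: rows are cleared from the bottom up, using the columns
   of u indexed by the i < j with w i < w j. *)
Lemma clear_column (j : 'I_n) (m : nat) : exists c : 'cV[K]_n,
  [/\ c j 0 = 1,
      forall i : 'I_n, c i 0 != 0 -> (i <= j)%N /\ (w i <= w j)%N &
      forall i : 'I_n, (n <= i + m)%N -> i != j -> (i, j) \notin inversions w ->
        (u *m c) i 0 = 0].
Proof.
elim: m => [|m [c [cj csupp cz]]].
  exists (delta_mx j 0); split=> [|i|i]; first by rewrite mxE !eqxx.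
    by rewrite mxE andbT; have [->|_] := eqVneq i j; rewrite ?leqnn // eqxx.
  by rewrite addn0 leqNgt ltn_ord.
have [ltmn|] := ltnP m n; last first.
  move=> lenm; exists c; split=> // i _; apply: cz.
  by rewrite (leq_trans lenm) ?leq_addl.
have lt0 : (n - m.+1 < n)%N by rewrite ltn_subrL (leq_ltn_trans _ ltmn).
(* Passing from m to m+1 adds the single row n-m-1 to those to be cleared. *)
pose i0 := Ordinal lt0.
have i0E (i : 'I_n) : (n <= i + m.+1)%N -> i = i0 \/ (n <= i + m)%N /\ (i0 < i)%N.
  move=> le; have [lt|ge] := ltnP i0 i; last first.
    by left; apply: val_inj; rewrite /=; move: ge le => /=; lia.
  by right; split=> //; move: lt => /=; lia.
case: (boolP [&& i0 != j, (i0 < j)%N & (w i0 < w j)%N]) => [/and3P[neq ltj ltw]|no].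
  (* Column i0 of u is 1 in row i0 and 0 below it, so subtracting this multiple clears row i0 and
     leaves the rows already treated unchanged. *)
  exists (c - (u *m c) i0 0 *: delta_mx i0 0); split=> [|i|i le neqi notinv].
  - by rewrite !mxE cj eq_sym (negPf neq) mulr0 subr0.
  - rewrite !mxE andbT; have [-> _|_] := eqVneq i i0; first by split; apply: ltnW.
    by rewrite mulr0 subr0; apply: csupp.
  - rewrite mulmxBr -scalemxAr -colE [LHS]mxE [X in _ + X]mxE.
    rewrite [X in _ - X]mxE [X in _ - _ * X]mxE.
    have [->|[le' lt']] := i0E i le; first by rewrite u1 mulr1 subrr.
    by rewrite uU // mulr0 subr0 cz.
(* Otherwise row i0 needs no change: it is row j, or (i0, j) is an inversion, or i0 > j and the
   entry is 0 already because c is supported in rows up to j and u is upper triangular. *)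
exists c; split=> // i le neqi notinv; have [ii0|[le' _]] := i0E i le; last exact: cz.
move: no neqi notinv; rewrite -ii0 => no neqi; rewrite inE /= => notinv.
have [ltij|leji] := ltnP i j.
  case: (ltngtP (w i) (w j)) => [lt|gt|eqw].
  - by rewrite neqi ltij lt in no.
  - by rewrite ltij gt in notinv.
  - by move: neqi; rewrite (perm_inj (val_inj eqw)) eqxx.
rewrite mxE; apply: big1 => l _; have [lti|gei] := ltnP l i.
  by rewrite uU ?mul0r.
have [->|/csupp[lelj _]] := eqVneq (c l 0) 0; first by rewrite mulr0.
by case/negP: neqi; rewrite -val_eqE eqn_leq leji (leq_trans gei lelj).
Qed.

(** The support condition makes c upper triangular both as it stands and after conjugation by w. The
    first keeps u c unipotent; the second lets c pass to the right of w as a triangular factor. *)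
Lemma clear_noninversions : exists c : 'M[K]_n,
  [/\ forall i, c i i = 1,
      forall i j : 'I_n, c i j != 0 -> (i <= j)%N /\ (w i <= w j)%N,
      forall i, (u *m c) i i = 1 &
      forall i j : 'I_n, i != j -> (i, j) \notin inversions w -> (u *m c) i j = 0].
Proof.
have [c cP] := fin_all_exists (fun j => clear_column j n).
pose C := \matrix_(i, j) c j i 0 : 'M[K]_n.
have uC i j : (u *m C) i j = (u *m c j) i 0.
  by rewrite !mxE; apply: eq_bigr => l _; rewrite mxE.
exists C; split=> [i|i j|i|i j neq ninv].
- by rewrite mxE; case: (cP i).
- by rewrite mxE; case: (cP j) => _ + _; apply.
- rewrite uC mxE (bigD1 i) //= u1 mul1r; case: (cP i) => -> csupp _.
  rewrite big1 ?addr0 // => l neq; have [ltl|gel] := ltnP l i.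
    by rewrite uU ?mul0r.
  have [->|/csupp[lel _]] := eqVneq (c i l 0) 0; first by rewrite mulr0.
  by case/negP: neq; rewrite -val_eqE eqn_leq gel lel.
- by rewrite uC; case: (cP j) => _ _; apply; rewrite ?leq_addl.
Qed.

End BruhatFactor.

(** * The generic matrix and its specializations *)

Section Generic.
Variables (n : nat) (w : 'S_n).

(** The shape of [Umat] over any commutative ring and with any values at the inversions, so that
    polynomial, rational and specialized versions are images of one another. *)
Definition inv_mx (R : comPzRingType) (x : 'I_#|inversions w| -> R) : 'M[R]_n :=
  1%:M + \sum_l x l *: delta_mx (enum_val l).1 (enum_val l).2.

Lemma eq_inv_mx (R : comPzRingType) (x y : 'I_#|inversions w| -> R) :
  x =1 y -> inv_mx x = inv_mx y.
Proof. by move=> eqxy; congr (_ + _); apply: eq_bigr => l _; rewrite eqxy. Qed.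

Lemma map_inv_mx (R R' : comPzRingType) (f : {rmorphism R -> R'}) x :
  map_mx f (inv_mx x) = inv_mx (f \o x).
Proof.
rewrite /inv_mx map_mxD map_mx1 raddf_sum; congr (_ + _).
by apply: eq_bigr => l _; rewrite /= map_mxZ map_delta_mx.
Qed.

Lemma inv_mx_entries (K : fieldType) (v : 'M[K]_n) :
  (forall i, v i i = 1) ->
  (forall i j, i != j -> (i, j) \notin inversions w -> v i j = 0) ->
  v = inv_mx (fun l => v (enum_val l).1 (enum_val l).2).
Proof.
move=> v1 v0; apply/matrixP => i j; rewrite !mxE summxE.
under eq_bigr => l _ do rewrite !mxE.
have [eqij|neq] := eqVneq i j.
  rewrite -eqij v1 big1 ?addr0 // => l _; case: andP => [[/eqP a /eqP b]|_].
    by have := enum_valP l; rewrite inE -a -b ltnn.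
  by rewrite mulr0.
rewrite add0r; have [ijinv|ninv] := boolP ((i, j) \in inversions w); last first.
  rewrite v0 // big1 // => l _; case: andP => [[/eqP a /eqP b]|_].
    by have := enum_valP l; rewrite [enum_val l]surjective_pairing -a -b (negPf ninv).
  by rewrite mulr0.
rewrite (bigD1 (enum_rank_in ijinv (i, j))) //= enum_rankK_in //= !eqxx mulr1.
rewrite big1 ?addr0 // => l; case: andP => [[/eqP a /eqP b]|_]; last by rewrite mulr0.
by rewrite {2}a {2}b -surjective_pairing enum_valK_in eqxx.
Qed.

Lemma compound_map k (R : comPzRingType) (K : fieldType) (f : {rmorphism R -> K})
    (g : 'M[R]_n) (S T : {set ksub n k}) :
  compound (map_mx f g) S T =
  map_mx f (\matrix_(i < #|S|, j < #|T|) minor g (Order.enum_val i) (Order.enum_val j)).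
Proof. by apply/matrixP => i j; rewrite !mxE -det_map_mx map_mxsub. Qed.

(** Full rank on the columns T survives multiplication by the triangular b, and u w b is a
    specialization of R(w). A maximal minor nonzero after specialization is a nonzero polynomial,
    hence nonzero in the fraction field. *)
Lemma generic_right_inv (F E : fieldType) (iota : {rmorphism F -> E}) k
    (S T : {set ksub n k}) (u : 'M[E]_n) :
  upper_unipotent u -> (forall s t, t \in T -> (s < t)%O -> s \in T) ->
  (exists X, compound (u *m perm_mx w) S T *m X = 1%:M) ->
  exists Y, compound (Rmat F w) S T *m Y = 1%:M.
Proof.
move=> u_unip downT [X uX].
have [c [c1 csupp uc1 uc0]] := clear_noninversions w u_unip.
pose b := perm_mx w^-1 *m c *m perm_mx w.
have bU (i j : 'I_n) : (j < i)%N -> b i j = 0.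
  move=> ltji; rewrite /b -row_permE -{2}[w]invgK -col_permE !mxE.
  apply: contraTeq ltji => /csupp[_]; by rewrite !permKV -leqNgt.
have bunit : b \in unitmx.
  rewrite !unitmx_mul !unitmx_perm andbT -unitmx_tr unitmxE det_trig.
    by rewrite big1 ?unitr1 // => i _; rewrite mxE.
  apply/is_trig_mxP => i j ltij; rewrite mxE; apply: contraTeq ltij => /csupp[].
  by rewrite -leqNgt.
have ub : u *m perm_mx w *m b = u *m c *m perm_mx w.
  by rewrite /b !mulmxA -[_ *m perm_mx w^-1]mulmxA -perm_mxM mulgV perm_mx1 mulmx1.
pose x (l : 'I_#|inversions w|) := (u *m c) (enum_val l).1 (enum_val l).2.
(* Evaluation is defined on polynomials but not on all fractions, so R(w) is first written over the
   polynomial ring; [ev] then maps coefficients to E and substitutes x. *)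
pose Q : 'M[{mpoly F[#|inversions w|]}]_n := inv_mx (fun l => 'X_l) *m perm_mx w.
pose ev := (meval x \o map_mpoly iota : {rmorphism {mpoly F[#|inversions w|]} -> E}).
have evQ : map_mx ev Q = u *m perm_mx w *m b.
  rewrite map_mxM map_perm_mx map_inv_mx ub [in RHS](inv_mx_entries uc1 uc0).
  congr (_ *m _); apply: eq_inv_mx => l.
  by rewrite /= map_mpolyX mevalXU.
have fracQ : map_mx (@FracField.tofrac _) Q = Rmat F w.
  by rewrite map_mxM map_perm_mx map_inv_mx.
have [f] : exists f, colsub f (compound (u *m perm_mx w *m b) S T) \in unitmx.
  apply: (@right_inv_unitmx_minor _ _ _ _ (invmx (compound b T T) *m X)).
  rewrite compound_mul_upper // -mulmxA mulKVmx //; exact: compound_upper_unit.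
rewrite -evQ compound_map -map_mxsub unitmxE det_map_mx => evdet.
apply: (@unitmx_minor_right_inv _ _ _ _ f).
rewrite -fracQ compound_map -map_mxsub unitmxE det_map_mx unitfE.
rewrite tofrac_eq0; apply: contraTneq evdet => ->.
by rewrite rmorph0 unitr0.
Qed.

End Generic.

(** * Partial shifts counted by the rank of compound matrices *)

Section PartialShiftRank.
Variables (K : fieldType) (n k : nat) (g : 'M[K]_n) (S : {set ksub n k}).
Implicit Types T : {set ksub n k}.

Definition minor_col (t : ksub n k) : 'cV[K]_#|S| :=
  \col_i minor g (Order.enum_val i) t.

Lemma col_compound T j : col j (compound g S T) = minor_col (Order.enum_val j).
Proof. by apply/colP => i; rewrite !mxE. Qed.

Lemma ind_compound T : ind (compound g S T) = pivots minor_col T.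
Proof. exact/ind_pivots/col_compound. Qed.

Lemma ind_compound_down T :
  (forall s t, t \in T -> (s < t)%O -> s \in T) ->
  ind (compound g S T) = partial_shift g S :&: T.
Proof. by move=> downT; rewrite /partial_shift !ind_compound; apply: pivots_down. Qed.

Lemma card_ind_compound_max T : (#|ind (compound g S T)| <= #|S|)%N.
Proof.
rewrite ind_compound card_pivots.
by rewrite (leq_trans (dimvS (subvf _))) // dimvf /dim /= muln1.
Qed.

(** The number of pivots is the dimension of the column span, which equals the number of rows
    exactly when the columns span everything. *)
Lemma card_ind_compoundP T :
  #|ind (compound g S T)| = #|S| <-> exists X, compound g S T *m X = 1%:M.
Proof.
rewrite ind_compound card_pivots -span_cols_fullP.
have -> : <<[seq minor_col t | t <- enum T]>>%VS =
    <<[seq col j (compound g S T) | j <- enum 'I_#|T|]>>%VS.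
  apply: eq_span => z; apply/mapP/mapP => -[t]; rewrite mem_enum => tT ->.
    exists (Order.enum_rank_in tT t); first by rewrite mem_enum.
    by rewrite col_compound Order.EnumVal.enum_rankK_in.
  by exists (Order.enum_val t); rewrite ?mem_enum ?Order.EnumVal.enum_valP ?col_compound.
have dimf : \dim {: 'cV[K]_#|S|} = #|S| by rewrite dimvf /dim /= muln1.
split=> [dimE|->]; last by [].
by apply/eqP; rewrite eqEdim subvf dimf dimE /=.
Qed.

Lemma card_partial_shift : g \in unitmx -> #|partial_shift g S| = #|S|.
Proof.
move=> gu; apply/card_ind_compoundP; exists (compound (invmx g) setT S).
by rewrite -compound_mul mulmxV // compound1.
Qed.

End PartialShiftRank.

(** * Correctness of the algorithm *)

Unset Implicit Arguments.

Theorem mainTheorem1 (F E : fieldType) (iota : {rmorphism F -> E})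
    (n k : nat) (n_gt0 : (0 < n)%N) (k_gt0 : (0 < k)%N)
    (S : {set ksub n k}) (S_neq0 : S != set0)
    (w : 'S_n) (u : 'M[E]_n) (u_unip : upper_unipotent u) :
  (algorithmA F S w u true <->
     partial_shift (Rmat F w) S = partial_shift (u *m perm_mx w) S) /\
  (algorithmA F S w u false <->
     partial_shift (Rmat F w) S <> partial_shift (u *m perm_mx w) S).
Proof.
set D := partial_shift (Rmat F w) S; set S' := partial_shift (u *m perm_mx w) S.
have downlt (x : ksub n k) s t : t \in below x -> (s < t)%O -> s \in below x.
  by rewrite !inE => lt /Order.POrderTheory.lt_trans; apply.
have uunit : u *m perm_mx w \in unitmx.
  rewrite unitmx_mul unitmx_perm andbT -unitmx_tr unitmxE det_trig.
    by rewrite big1 ?unitr1 // => i _; rewrite mxE u_unip.2.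
  by apply/is_trig_mxP => i j ltij; rewrite mxE u_unip.1.
have cardS' : #|S'| = #|S| by apply: card_partial_shift.
have [x0 x0S] : exists x, x \in S'.
  by apply/set0Pn; rewrite -card_gt0 cardS' card_gt0.
have [smax smaxP] : exists smax, lexmax S' smax.
  exists (Order.arg_max x0 (mem S') id).
  by case: Order.TotalTheory.arg_maxP.
have maxU x : lexmax S' x -> x = smax.
  case: smaxP => mS' maxm [xS' maxx].
  by apply/Order.POrderTheory.le_anti; rewrite maxx ?maxm.
pose T1 := smax |: below smax.
have T1E t : (t \in T1) = (t <= smax)%O.
  by rewrite !inE Order.POrderTheory.le_eqVlt.
have downT1 s t : t \in T1 -> (s < t)%O -> s \in T1.
  by rewrite !T1E => le /Order.POrderTheory.ltW /Order.POrderTheory.le_trans; apply.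
have cardT1 : #|T1| = #|below smax|.+1.
  by rewrite cardsU1 inE Order.POrderTheory.ltxx.
have S'T1 : S' \subset T1.
  by apply/subsetP => t /smaxP.2; rewrite T1E.
(* All |S| pivots of u w lie in [T1], so its compound has full rank there, and so does that of R(w).
   This gives |S| pivots of R(w) inside [T1], and D has at most |S| elements in total. *)
have [cardD DT1] : #|D| = #|S| /\ D \subset T1.
  have : #|ind (compound (Rmat F w) S T1)| = #|S|.
    apply/card_ind_compoundP/(generic_right_inv iota u_unip downT1).
    apply/card_ind_compoundP; rewrite ind_compound_down // -/S'.
    by rewrite (setIidPl S'T1).
  rewrite ind_compound_down // -/D => cDT1.
  have cD : #|D| = #|S|.
    apply/eqP; rewrite eqn_leq card_ind_compound_max -cDT1 subset_leq_card //.
    exact: subsetIl.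
  by split=> //; apply/setIidPl/eqP; rewrite eqEcard subsetIl cDT1 cD /=.
(* The form m sees the part of D strictly below [smax]; as D lies weakly below [smax], only [smax]
   itself can be missing. *)
have indE m : row_echelon_form_of (compound (Rmat F w) S (below smax)) m ->
    ind m = D :\ smax.
  case=> _ [P Pu ->]; rewrite ind_unitmx // ind_compound_down; last exact: downlt.
  apply/setP => t; rewrite !inE Order.POrderTheory.lt_neqAle.
  case: (boolP (t \in D)) => [tD|]; rewrite ?andbF //=.
  by have := subsetP DT1 t tD; rewrite T1E => ->; rewrite !andbT.
have smaxS' := smaxP.1.
(* As D and S' have equal size, agreement away from [smax], which lies in S', forces [smax] into
   D. *)
have eqD : (D :\ smax == S' :\ smax) = (D == S').
  apply/eqP/eqP => [eqD1|-> //].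
  have smaxD : smax \in D.
    have := cardsD1 smax D; rewrite eqD1 cardD -cardS' (cardsD1 smax S') smaxS'.
    by case: (smax \in D) => //= /eqP; rewrite eqn_add2r.
  by rewrite -(setD1K smaxD) eqD1 setD1K.
(* Here S' fills the whole segment [T1], and D is a subset of [T1] of the same size. *)
have initD : #|S'| = #|below smax|.+1 -> D = S'.
  rewrite -cardT1 => c; have -> : S' = T1 by apply/eqP; rewrite eqEcard S'T1 c /=.
  by apply/eqP; rewrite eqEcard DT1 cardD -cardS' c /=.
(* Every run has the same outcome, whichever row echelon form it uses; together with the existence
   of a run this settles both equivalences. *)
have runA b : algorithmA F S w u b -> b = (D == S').
  case=> [x S1 T lm c|x m S1 T lm c em].
    by apply/esym/eqP/initD; move: c; rewrite /T (maxU x lm).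
  have ex := maxU x lm; rewrite /T ex in m em *.
  rewrite -eqD -(indE m em) //.
have run : algorithmA F S w u (D == S').
  suff [b Ab] : exists b, algorithmA F S w u b by rewrite -(runA b Ab).
  have [c|c] := eqVneq #|S'| #|below smax|.+1.
    by exists true; apply: AlgorithmA_initial smaxP c.
  have [m em] := row_echelon_form_exists (compound (Rmat F w) S (below smax)).
  by eexists; apply: AlgorithmA_echelon smaxP _ em; apply/eqP.
split; split=> [/runA/esym/eqP //|eqDS]; first by rewrite eqDS eqxx in run.
by move/eqP/negbTE: eqDS run => ->.
Qed.
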